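(* If $A\in 2^\omega$ is almost everywhere dominating, then there is a 2-random set $R$ whose Turing degree is c.e. in $A$.
   Context: $\mu$ is the fair-coin (Lebesgue) probability measure on $2^\omega$; ''almost all'' means on a set of $\mu$-measure $1$. A Martin-Löf test relative to a set $A$ is a sequence $\langle U_n:n\in\omega\rangle$ of $\Sigma^{0,A}_1$ classes in $2^\omega$, uniform in $A$, with $\mu(U_n)\leq 2^{-n}$ for each $n$. A set $R$ is 2-random if for every Martin-Löf test $\langle U_n\rangle$ relative to $0'$, $R\notin\bigcap_n U_n$. For $f,g\in\omega^\omega$, $f$ dominates $g$ if $\exists m\,\forall n>m\,(f(n)>g(n))$. A set $A$ is almost everywhere (a.e.) dominating if for almost all $X\in 2^\omega$ and all functions $g\leq_T X$, there is a function $f\leq_T A$ such that $f$ dominates $g$. The degree of $R$ is c.e. in $A$ if there is a set $N\equiv_T R$ which is computably enumerable in $A$. *)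

(* Defs.v *)
From HB Require Import structures.
From Stdlib Require Arith.Cantor.
From mathcomp Require Import all_boot all_order all_algebra.
From mathcomp Require Import all_classical all_reals all_analysis.
From mathcomp Require Import measurable_realfun zify ring lra.
Import Order.TTheory GRing.Theory Num.Theory.
Import numFieldNormedType.Exports.

Set Implicit Arguments.
Unset Strict Implicit.
Unset Printing Implicit Defensive.

Local Open Scope classical_set_scope.

(* Programs for partial functions nat -> nat with an oracle; several arguments
   are passed as one number through the Cantor pairing. *)
Inductive code : Type :=
| cZero | cSucc | cFst | cSnd | cOracle
| cPair of code & code
| cComp of code & code
| cPrec of code & code
| cMin of code.

Definition pairn (x y : nat) : nat := Cantor.to_nat (x, y).
Definition fstn (n : nat) : nat := (Cantor.of_nat n).1.
Definition sndn (n : nat) : nat := (Cantor.of_nat n).2.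

(* [computes X c n m]: with oracle X, program c halts on input n with output m.
   In the [cPrec] case, h lists the successive values of the recursion
   h 0 = a(x), h (i+1) = b(x, i, h i), run up to i = y, on the input (x, y). *)
Fixpoint computes (X : nat -> bool) (c : code) (n m : nat) {struct c} : Prop :=
  match c with
  | cZero => m = 0
  | cSucc => m = n.+1
  | cFst => m = fstn n
  | cSnd => m = sndn n
  | cOracle => m = nat_of_bool (X n)
  | cPair a b =>
      exists u v, [/\ computes X a n u, computes X b n v & m = pairn u v]
  | cComp a b => exists2 u, computes X b n u & computes X a u m
  | cPrec a b =>
      exists h : nat -> nat,
        [/\ computes X a (fstn n) (h 0),
            forall i, i < sndn n ->
              computes X b (pairn (fstn n) (pairn i (h i))) (h i.+1)
          & m = h (sndn n)]
  | cMin a =>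
      computes X a (pairn n m) 0 /\
      forall i, i < m -> exists k, computes X a (pairn n i) k.+1
  end.

Lemma computes_functional X c n m1 m2 :
  computes X c n m1 -> computes X c n m2 -> m1 = m2.
Proof.
elim: c n m1 m2 => /=.
1-5: by move=> n m1 m2 -> ->.
- move=> a IHa b IHb n m1 m2 [u1 [v1 [au1 bv1 ->]]] [u2 [v2 [au2 bv2 ->]]].
  by rewrite (IHa _ _ _ au1 au2) (IHb _ _ _ bv1 bv2).
- move=> a IHa b IHb n m1 m2 [u1 bu1 au1] [u2 bu2 au2].
  by rewrite -(IHb _ _ _ bu1 bu2) in au2; exact: IHa au1 au2.
- move=> a IHa b IHb n m1 m2 [h1 [a1 b1 ->]] [h2 [a2 b2 ->]].
  have H i : i <= sndn n -> h1 i = h2 i.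
    elim: i => [_|i IHi lti]; first exact: IHa a1 a2.
    have := b1 _ lti; rewrite (IHi (ltnW lti)) => b1i.
    exact: IHb b1i (b2 _ lti).
  exact: H.
- move=> a IHa n m1 m2 [a1 lt1] [a2 lt2].
  case: (ltngtP m1 m2) => // lt12.
  + by have [k ak] := lt2 _ lt12; have := IHa _ _ _ a1 ak.
  + by have [k ak] := lt1 _ lt12; have := IHa _ _ _ a2 ak.
Qed.

Fixpoint code_index (c : code) : nat :=
  match c with
  | cZero => 0
  | cSucc => 1
  | cFst => 2
  | cSnd => 3
  | cOracle => 4
  | cPair a b => 5 + 4 * pairn (code_index a) (code_index b)
  | cComp a b => 6 + 4 * pairn (code_index a) (code_index b)
  | cPrec a b => 7 + 4 * pairn (code_index a) (code_index b)
  | cMin a => 8 + 4 * code_index a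
  end.

Lemma pairn_inj a b c d : pairn a b = pairn c d -> a = c /\ b = d.
Proof. by move/Cantor.to_nat_inj => [-> ->]. Qed.

Lemma code_index_inj : injective code_index.
Proof.
elim=> [|||||a IHa b IHb|a IHa b IHb|a IHa b IHb|a IHa];
  case=> [|||||a' b'|a' b'|a' b'|a'] //= e; try lia.
1-3: have /pairn_inj[/IHa -> /IHb ->] :
  pairn (code_index a) (code_index b) = pairn (code_index a') (code_index b')
  by lia.
1-3: by [].
by congr cMin; apply: IHa; lia.
Qed.

Lemma code_index_surj n : exists c, code_index c = n.
Proof.
elim/ltn_ind: n => n IH.
case: (ltnP n 5) => n5.
  case: n n5 IH => [|[|[|[|[|//]]]]] _ _;
  by [exists cZero|exists cSucc|exists cFst|exists cSnd|exists cOracle].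
have nE := divn_eq (n - 5) 4.
set q := (n - 5) %/ 4 in nE; set r := (n - 5) %% 4 in nE.
have r4 : r < 4 by rewrite ltn_mod.
have qlt : q < n by lia.
have qE : pairn (fstn q) (sndn q) = q.
  by rewrite /pairn /fstn /sndn -surjective_pairing Cantor.cancel_to_of.
have /ssrnat.leP qle := Cantor.to_nat_non_decreasing (fstn q) (sndn q).
rewrite -/(pairn _ _) qE in qle.
have [a ea] : exists c, code_index c = fstn q by apply: IH; lia.
have [b eb] : exists c, code_index c = sndn q by apply: IH; lia.
have [d ed] := IH _ qlt.
have [r0|[r1|[r2|r3]]] : r = 0 \/ r = 1 \/ r = 2 \/ r = 3 by lia.
- by exists (cPair a b) => /=; rewrite ea eb qE; lia.
- by exists (cComp a b) => /=; rewrite ea eb qE; lia.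
- by exists (cPrec a b) => /=; rewrite ea eb qE; lia.
- by exists (cMin d) => /=; rewrite ed; lia.
Qed.

Definition fun_turing_le (g : nat -> nat) (X : nat -> bool) : Prop :=
  exists c, forall n, computes X c n (g n).

Definition turing_le (Y X : nat -> bool) : Prop :=
  fun_turing_le (fun n => nat_of_bool (Y n)) X.

Definition turing_equiv (Y X : nat -> bool) : Prop :=
  turing_le Y X /\ turing_le X Y.

Definition ce_in (X : nat -> bool) (W : set nat) : Prop :=
  exists c, W = [set n | exists m, computes X c n m].

Definition zero_jump : nat -> bool :=
  fun n => `[< exists2 c, code_index c = n &
                 exists m, computes (fun=> false) c n m >].

Definition degree_ce_in (Z A : nat -> bool) : Prop :=
  exists N : nat -> bool, turing_equiv N Z /\ ce_in A [set n | N n].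

Definition dominates_fun (f g : nat -> nat) : Prop :=
  exists m, forall n, m < n -> g n < f n.

Definition cylinder (s : seq bool) : set (nat -> bool) :=
  [set X | mkseq X (size s) = s].

(* 2^omega with its Borel sigma-algebra, generated by the basic open sets *)
Definition cantor_set := g_sigma_algebraType (range cylinder).

Local Open Scope ring_scope.

(* digit n of the binary expansion of x, for 0 <= x < 1 *)
Definition binary_digits (R : realType) (x : measurableTypeR R) : cantor_set :=
  fun n => odd (Num.truncn ((x : R) * 2 ^+ n.+1)).

Lemma truncn_double (R : realType) (y : R) :
  Num.truncn (y * 2) = ((Num.truncn (y * 2)) %% 2 + 2 * Num.truncn y)%N.
Proof.
have [y0|y0] := leP 0 y; last first.
  rewrite !truncn_floor !leNgt y0 /=.
  by rewrite pmulr_llt0 // y0.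
have /andP[h1 h2] := truncn_itv y0.
have /andP[h3 h4] : (Num.truncn (y * 2))%:R <= y * 2 < (Num.truncn (y * 2)).+1%:R.
  by apply: truncn_itv; lra.
set t := Num.truncn y in h1 h2 *; set u := Num.truncn _ in h3 h4 *.
have : (2 * t < u.+1)%N by rewrite -(ltr_nat R) natrM; lra.
have : (u < 2 * t.+1)%N by rewrite -(ltr_nat R) natrM; lra.
lia.
Qed.

Lemma measurable_truncn_scaled (R : realType) (P : pred nat) (c : R) :
  measurable [set x : R | P (Num.truncn (x * c))].
Proof.
have mge k : measurable [set x : R | (k < Num.truncn (x * c))%N].
  have -> : [set x : R | (k < Num.truncn (x * c))%N] =
            setT `&` ( *%R^~ c) @^-1` `[k.+1%:R, +oo[%classic.
    by apply/seteqP; split=> x /=; rewrite ?setTI in_itv /= andbT truncn_gt_nat; [move=> ->|case].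
  exact: (mulrr_measurable c).
have -> : [set x : R | P (Num.truncn (x * c))] =
  \bigcup_(k in [set k | P k])
    ([set x : R | (k < (Num.truncn (x * c)).+1)%N] `\`
     [set x : R | (k < Num.truncn (x * c))%N]).
  apply/seteqP; split=> x /=.
    by move=> Px; exists (Num.truncn (x * c)) => //=; split; rewrite /= ?ltnn.
  move=> [k /= Pk [/= + /negP]]; rewrite -leqNgt ltnS => k1 k2.
  by have -> : Num.truncn (x * c) = k by apply/eqP; rewrite eqn_leq k1 k2.
apply: bigcup_measurable => k _; apply: measurableD; last exact: mge.
case: k => [|k]; last exact: (mge k).
by rewrite (_ : [set _ | _] = setT) //; apply/seteqP; split.
Qed.

Lemma cylinder_rcons s b :
  cylinder (rcons s b) = cylinder s `&` [set X | X (size s) = b].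
Proof.
apply/seteqP; split=> X; rewrite /cylinder /= size_rcons mkseqS.
  by move=> /rcons_inj[-> ->].
by move=> [-> ->].
Qed.

Lemma measurable_binary_digits (R : realType) :
  measurable_fun [set: R] (@binary_digits R).
Proof.
apply: (@measurability _ _ R cantor_set setT (@binary_digits R) (range cylinder)) => [//|_ [_ [s _ <-] <-]].
rewrite setTI; elim/last_ind: s => [|s b IH].
  by rewrite (_ : _ @^-1` _ = setT) //; apply/seteqP; split.
rewrite cylinder_rcons preimage_setI; apply: measurableI => //.
have := measurable_truncn_scaled (fun k => odd k == b) ((2 : R) ^+ (size s).+1).
by congr measurable; apply/seteqP; split=> x /=; rewrite /binary_digits => /eqP.
Qed.

HB.instance Definition _ (R : realType) :=
  isMeasurableFun.Build _ _ (measurableTypeR R) cantor_set (@binary_digits R)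
    (@measurable_binary_digits R).

(* The law of the binary digits of a uniform point of [0, 1]; the lemma
   [fair_coin_cylinder] below gives the usual characterization. *)
Definition fair_coin (R : realType) : probability cantor_set R :=
  distribution (uniform_prob (@ltr01 R)) (@binary_digits R).

Lemma binary_digits_cylinder (R : realType) (s : seq bool) (x : R) :
  0 <= x -> x < 1 ->
  cylinder s (binary_digits x) <->
  Num.truncn (x * 2 ^+ size s) = foldl (fun k (b : bool) => 2 * k + b)%N 0%N s.
Proof.
move=> x0 x1; elim/last_ind: s => [|s b [IH1 IH2]].
  rewrite expr0 mulr1 /=; split=> // _.
  by apply/eqP; rewrite truncn_eq // x0 x1.
rewrite cylinder_rcons size_rcons foldl_rcons exprSr mulrA truncn_double.
have -> : (cylinder s `&` [set X : nat -> bool | X (size s) = b]) (binary_digits x) =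
          (cylinder s (binary_digits x) /\
           odd (Num.truncn (x * 2 ^+ size s * 2)) = b).
  by rewrite /= /setI /= /binary_digits exprSr mulrA.
split.
  by move=> [/IH1 -> /= <-]; rewrite modn2 addnC.
move=> e; have b2 : (b < 2)%N by case: b {e}.
have e1 : Num.truncn (x * 2 ^+ size s) = foldl (fun k (b : bool) => 2 * k + b)%N 0%N s.
  have := ltn_pmod (Num.truncn (x * 2 ^+ size s * 2)) (isT : 0 < 2)%N.
  lia.
split; first exact: IH2.
move: e; rewrite e1 modn2 addnC => /addnI /=.
by case: odd; case: b {b2}.
Qed.

Lemma fair_coin_cylinder (R : realType) (s : seq bool) :
  fair_coin R (cylinder s) = (2^-1 ^+ size s)%:E.
Proof.
pose n := size s; pose k := foldl (fun k (b : bool) => 2 * k + b)%N 0%N s.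
have p0 : (0 : R) < 2 ^+ n by rewrite exprn_gt0.
have ltk : (k < 2 ^ n)%N.
  rewrite /k /n; elim/last_ind: (s) => [//|t b IH].
  rewrite foldl_rcons size_rcons expnS.
  by case: b; lia.
pose E : set R := @binary_digits R @^-1` cylinder s.
pose F : set R := `[k%:R / 2 ^+ n, k.+1%:R / 2 ^+ n[%classic.
have mE : measurable E.
  rewrite -[E]setTI; apply: measurable_binary_digits => //.
  by apply: sub_sigma_algebra; exists s.
have EF x : 0 <= x -> x < 1 -> E x <-> F x.
  move=> x0 x1; have H := binary_digits_cylinder s x0 x1.
  suff -> : F x = (Num.truncn (x * 2 ^+ n) = k) :> Prop by exact: H.
  rewrite /F /= in_itv /= ler_pdivrMr // ltr_pdivlMr //.
  rewrite -truncn_eq ?mulr_ge0 // ?ltW //.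
  by apply/propext; split=> /eqP.
have F01 x : F x -> 0 <= x < 1.
  rewrite /F /= in_itv /= => /andP[h1 h2]; apply/andP; split.
    by apply: le_trans h1; rewrite divr_ge0 // ltW.
  apply: (lt_le_trans h2); rewrite ler_pdivrMr // mul1r.
  by rewrite -natrX ler_nat.
have lF : lebesgue_measure F = (2^-1 ^+ n)%:E.
  rewrite lebesgue_measure_itv /= lte_fin ltr_pM2r ?invr_gt0 // ltr_nat leqnn.
  rewrite -EFinD; congr EFin.
  by rewrite -mulrBl -natrB // subSn // subnn mul1r exprVn.
have mF : measurable F by exact: measurable_itv.
have -> : fair_coin R (cylinder s) = lebesgue_measure (E `&` `[0, 1]%classic).
  rewrite /fair_coin /distribution /pushforward /= /uniform_prob.
  rewrite integral_uniform_pdf -/E (eq_integral (cst 1%E)).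
    by rewrite integral_cst ?mul1e //; apply: measurableI.
  move=> x; rewrite inE /= => -[_]; rewrite /uniform_pdf in_itv /= => ->.
  by rewrite subr0 invr1.
apply/eqP; rewrite -lF eq_le; apply/andP; split.
  apply: (@le_trans _ _ (lebesgue_measure (F `|` [set 1]))).
    apply: le_measure; rewrite ?inE.
    - by apply: measurableI.
    - by apply: measurableU.
    move=> x [Ex]; rewrite /= in_itv /= => /andP[x0]; rewrite le_eqVlt.
    by move=> /orP[/eqP ->|x1]; [right|left; apply/EF].
  apply: (le_trans (measureU2 _ _ _)) => //.
  rewrite -[leRHS]adde0 leeD2l // le_eqVlt; apply/orP; left; apply/eqP.
  exact: (lebesgue_measure_set1 (1 : R)).
apply: le_measure; rewrite ?inE //; first by apply: measurableI.
move=> x Fx; have /andP[x0 x1] := F01 _ Fx; split; first exact/EF.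
by rewrite /= in_itv /= x0 ltW.
Qed.

Definition str_index (s : seq bool) : nat :=
  foldr (fun (b : bool) k => (2 * k + 1 + b)%N) 0%N s.

Lemma str_index_bij : bijective str_index.
Proof.
have inj : injective str_index.
  elim=> [|b s IH] [|b' s'] //=; rewrite -?/(str_index _); try lia.
  by move=> e; congr cons; [case: b b' e => -[] //=; lia|apply: IH; lia].
have surj n : exists s, str_index s = n.
  elim/ltn_ind: n => -[_|n IH]; first by exists [::].
  have [s es] : exists s, str_index s = n./2 by apply: IH; lia.
  by exists (odd n :: s); rewrite /= -/(str_index s) es; lia.
have [g gK] := choice surj.
by exists g => // s; apply: inj.
Qed.

(* A Sigma^{0,X}_1 class is a union of an X-c.e. family of basic open sets;
   uniformity means that one X-c.e. set W of pairs enumerates all the U_n. *)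
Definition uniformly_Sigma1 (X : nat -> bool) (U : nat -> set cantor_set) : Prop :=
  exists2 W : set nat, ce_in X W &
    forall n, U n = \bigcup_(s in [set s | W (pairn n (str_index s))]) cylinder s.

Definition ML_test (R : realType) (X : nat -> bool) (U : nat -> set cantor_set) :
    Prop :=
  uniformly_Sigma1 X U /\ forall n, (fair_coin R (U n) <= (2^-1 ^+ n)%:E)%E.

Definition two_random (R : realType) (Z : nat -> bool) : Prop :=
  forall U, ML_test R zero_jump U -> ~ (\bigcap_n U n) Z.

Definition ae_dominating (R : realType) (A : nat -> bool) : Prop :=
  {ae fair_coin R, forall X : cantor_set, forall g, fun_turing_le g X ->
     exists2 f, fun_turing_le f A & dominates_fun f g}.

(* Main.v *)
Require Import Defs.
From Stdlib Require Arith.Cantor.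
From mathcomp Require Import all_boot all_order all_algebra.
From mathcomp Require Import all_classical all_reals all_analysis.
From mathcomp Require Import zify lra.

(* The non-2-random sets are covered by a Sigma^0_2 class S of measure at most
   1/2: the union of the strings sigma for which some (e, u) satisfies "sigma is
   captured by the e-th (trimmed) test relative to 0'_v, for all v >= u", where
   0'_v is the stage v approximation of the halting set. For X outside S, the
   function g sending (sigma, e, u) to the least v refuting this (or to 0 if sigma
   is not a prefix of X) is total and computable in X. Choose X outside S in the
   measure one set where A-computable functions dominate, and f computable in A
   with g <= f everywhere. The strings whose refutation does not show up by stage
   f(sigma, e, u) form an A-computable set; the class of the sets Y with no prefix
   in it is a Pi^0_1 class relative to A, contains X, and is disjoint from S. Its
   leftmost member is 2-random and has the degree of its left cut, which is c.e.
   in A. *)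

Set Implicit Arguments.
Unset Strict Implicit.
Unset Printing Implicit Defensive.
Import Order.TTheory GRing.Theory Num.Theory.
Import numFieldNormedType.Exports.
Local Open Scope classical_set_scope.

(** * Closure properties of relative computability *)

Lemma fstn_pair x y : fstn (pairn x y) = x.
Proof. by rewrite /fstn /pairn Cantor.cancel_of_to. Qed.

Lemma sndn_pair x y : sndn (pairn x y) = y.
Proof. by rewrite /sndn /pairn Cantor.cancel_of_to. Qed.

Lemma pairn_eta n : pairn (fstn n) (sndn n) = n.
Proof. by rewrite /pairn /fstn /sndn -surjective_pairing Cantor.cancel_to_of. Qed.

Lemma leq_pairn x y : x + y <= pairn x y.
Proof.
by have /ssrnat.leP := Cantor.to_nat_non_decreasing x y; rewrite /pairn; lia.
Qed.

Lemma turing_ext X f g : f =1 g -> fun_turing_le f X -> fun_turing_le g X.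
Proof. by move=> fg [c cf]; exists c => n; rewrite -fg. Qed.

Lemma turing_fst X : fun_turing_le fstn X. Proof. by exists cFst. Qed.
Lemma turing_snd X : fun_turing_le sndn X. Proof. by exists cSnd. Qed.

Lemma turing_id X : fun_turing_le id X.
Proof.
exists (cPair cFst cSnd) => n; exists (fstn n), (sndn n); split=> //.
by rewrite pairn_eta.
Qed.

Lemma turing_comp X f g :
  fun_turing_le f X -> fun_turing_le g X -> fun_turing_le (fun n => f (g n)) X.
Proof. by move=> [a fa] [b gb]; exists (cComp a b) => n; exists (g n). Qed.

Lemma turing_pair X f g : fun_turing_le f X -> fun_turing_le g X ->
  fun_turing_le (fun n => pairn (f n) (g n)) X.
Proof.
by move=> [a fa] [b gb]; exists (cPair a b) => n; exists (f n), (g n); split.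
Qed.

Lemma turing_fun2 X (F : nat -> nat -> nat) f g :
  fun_turing_le (fun q => F (fstn q) (sndn q)) X ->
  fun_turing_le f X -> fun_turing_le g X ->
  fun_turing_le (fun n => F (f n) (g n)) X.
Proof.
move=> cF cf cg; have := turing_comp cF (turing_pair cf cg).
by apply: turing_ext => n; rewrite fstn_pair sndn_pair.
Qed.

Lemma turing_bool2 X (P : nat -> nat -> bool) f g :
  fun_turing_le (fun q => nat_of_bool (P (fstn q) (sndn q))) X ->
  fun_turing_le f X -> fun_turing_le g X ->
  fun_turing_le (fun n => nat_of_bool (P (f n) (g n))) X.
Proof. exact: (@turing_fun2 X (fun a b => nat_of_bool (P a b))). Qed.

Lemma turing_succ X f : fun_turing_le f X -> fun_turing_le (fun n => (f n).+1) X.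
Proof. by apply: (@turing_comp X succn); exists cSucc. Qed.

Lemma turing_const X k : fun_turing_le (fun=> k) X.
Proof. by elim: k => [|k IH]; [exists cZero|apply: turing_succ]. Qed.

Lemma turing_oracle X f :
  fun_turing_le f X -> fun_turing_le (fun n => nat_of_bool (X (f n))) X.
Proof. by apply: (@turing_comp X (fun n => nat_of_bool (X n))); exists cOracle. Qed.

(** [cPrec] expects the parameter paired with the number of steps. The recursion is therefore
    computed first with a free number of steps, and [b p] is substituted afterwards. *)
Lemma turing_iteri X (F b : nat -> nat) (G : nat -> nat -> nat -> nat) :
  fun_turing_le F X -> fun_turing_le b X ->
  fun_turing_le (fun q => G (fstn q) (fstn (sndn q)) (sndn (sndn q))) X ->
  fun_turing_le (fun p => iteri (b p) (G p) (F p)) X.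
Proof.
move=> [cf Hf] cb [cg Hg].
have H : fun_turing_le
    (fun q => iteri (sndn q) (G (fstn q)) (F (fstn q))) X.
  exists (cPrec cf cg) => n /=.
  exists (fun i => iteri i (G (fstn n)) (F (fstn n))); split => // i _.
  by have := Hg (pairn (fstn n) (pairn i (iteri i (G (fstn n)) (F (fstn n)))));
    rewrite !(fstn_pair, sndn_pair).
exact: (@turing_fun2 X (fun p k => iteri k (G p) (F p)) id b H (turing_id X) cb).
Qed.

Lemma turing_iteri_closed X (F b : nat -> nat) (g : nat -> nat -> nat) :
  fun_turing_le F X -> fun_turing_le b X ->
  fun_turing_le (fun q => g (fstn q) (sndn q)) X ->
  fun_turing_le (fun p => iteri (b p) g (F p)) X.
Proof.
move=> cF cb cg; apply: (@turing_iteri X F b (fun=> g)) => //.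
exact: (turing_comp cg (turing_snd X)).
Qed.

Lemma turing_addn X f g : fun_turing_le f X -> fun_turing_le g X ->
  fun_turing_le (fun n => f n + g n) X.
Proof.
move=> cf cg; apply: (@turing_ext X (fun n => iteri (g n) (fun _ r => r.+1) (f n))).
  by move=> n; elim: (g n) => [|k /= ->]; rewrite ?addn0 ?addnS.
by apply: turing_iteri_closed => //; apply: turing_succ; exact: turing_snd.
Qed.

Lemma turing_pred X f : fun_turing_le f X -> fun_turing_le (fun n => (f n).-1) X.
Proof.
move=> cf; apply: (@turing_ext X (fun n => iteri (f n) (fun i _ => i) 0)).
  by move=> n; case: (f n).
apply: turing_iteri_closed => //; [exact: turing_const|exact: turing_fst].
Qed.

Lemma turing_subn X f g : fun_turing_le f X -> fun_turing_le g X ->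
  fun_turing_le (fun n => f n - g n) X.
Proof.
move=> cf cg; apply: (@turing_ext X (fun n => iteri (g n) (fun _ r => r.-1) (f n))).
  by move=> n; elim: (g n) => [|k IH] /=; [rewrite subn0|rewrite IH subnS].
by apply: turing_iteri_closed => //; apply: turing_pred; exact: turing_snd.
Qed.

Lemma turing_muln X f g : fun_turing_le f X -> fun_turing_le g X ->
  fun_turing_le (fun n => f n * g n) X.
Proof.
move=> cf cg; apply: (@turing_ext X (fun n => iteri (g n) (fun _ r => r + f n) 0)).
  by move=> n; elim: (g n) => [|k /= ->]; rewrite ?muln0 ?mulnS 1?addnC.
apply: (@turing_iteri X (fun=> 0) g (fun n _ r => r + f n)) => //.
  exact: turing_const.
apply: turing_addn; last exact: turing_comp cf (turing_fst X).
exact: turing_comp (turing_snd X) (turing_snd X).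
Qed.

Lemma turing_expn X f g : fun_turing_le f X -> fun_turing_le g X ->
  fun_turing_le (fun n => f n ^ g n) X.
Proof.
move=> cf cg; apply: (@turing_ext X (fun n => iteri (g n) (fun _ r => r * f n) 1)).
  by move=> n; elim: (g n) => [|k /= ->]; rewrite ?expn0 ?expnSr.
apply: (@turing_iteri X (fun=> 1) g (fun n _ r => r * f n)) => //.
  exact: turing_const.
apply: turing_muln; last exact: turing_comp cf (turing_fst X).
exact: turing_comp (turing_snd X) (turing_snd X).
Qed.

Lemma turing_leq X f g : fun_turing_le f X -> fun_turing_le g X ->
  fun_turing_le (fun n => nat_of_bool (f n <= g n)) X.
Proof.
move=> cf cg; apply: (@turing_ext X (fun n => 1 - (f n - g n))).
  by move=> n; case: leqP; lia.
by do 2?apply: turing_subn => //; exact: turing_const.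
Qed.

Lemma turing_neg X (b : nat -> bool) : fun_turing_le (fun n => nat_of_bool (b n)) X ->
  fun_turing_le (fun n => nat_of_bool (~~ b n)) X.
Proof.
move=> cb; apply: (@turing_ext X (fun n => 1 - b n)); first by move=> n; case: (b n).
by apply: turing_subn => //; exact: turing_const.
Qed.

Lemma turing_and X (a b : nat -> bool) :
  fun_turing_le (fun n => nat_of_bool (a n)) X ->
  fun_turing_le (fun n => nat_of_bool (b n)) X ->
  fun_turing_le (fun n => nat_of_bool (a n && b n)) X.
Proof.
move=> ca cb; apply: (@turing_ext X (fun n => a n * b n)).
  by move=> n; rewrite mulnb.
exact: turing_muln.
Qed.

Lemma turing_or X (a b : nat -> bool) :
  fun_turing_le (fun n => nat_of_bool (a n)) X ->
  fun_turing_le (fun n => nat_of_bool (b n)) X ->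
  fun_turing_le (fun n => nat_of_bool (a n || b n)) X.
Proof.
move=> ca cb; apply: (@turing_ext X (fun n => nat_of_bool (~~ (~~ a n && ~~ b n)))).
  by move=> n; case: (a n); case: (b n).
by apply: turing_neg; apply: turing_and; apply: turing_neg.
Qed.

Lemma turing_imply X (a b : nat -> bool) :
  fun_turing_le (fun n => nat_of_bool (a n)) X ->
  fun_turing_le (fun n => nat_of_bool (b n)) X ->
  fun_turing_le (fun n => nat_of_bool (a n ==> b n)) X.
Proof.
move=> ca cb; apply: (@turing_ext X (fun n => nat_of_bool (~~ a n || b n))).
  by move=> n; case: (a n); case: (b n).
by apply: turing_or => //; apply: turing_neg.
Qed.

Lemma turing_eqn X f g : fun_turing_le f X -> fun_turing_le g X ->
  fun_turing_le (fun n => nat_of_bool (f n == g n)) X.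
Proof.
move=> cf cg; apply: (@turing_ext X (fun n => nat_of_bool ((f n <= g n) && (g n <= f n)))).
  by move=> n; rewrite eqn_leq.
by apply: turing_and; apply: turing_leq.
Qed.

Lemma turing_eqb X (a b : nat -> bool) :
  fun_turing_le (fun n => nat_of_bool (a n)) X ->
  fun_turing_le (fun n => nat_of_bool (b n)) X ->
  fun_turing_le (fun n => nat_of_bool (a n == b n)) X.
Proof.
move=> ca cb; apply: (@turing_ext X (fun n => nat_of_bool (nat_of_bool (a n) == b n))).
  by move=> n; case: (a n); case: (b n).
exact: turing_eqn.
Qed.

Lemma turing_ifb X (b f g : nat -> bool) :
  fun_turing_le (fun n => nat_of_bool (b n)) X ->
  fun_turing_le (fun n => nat_of_bool (f n)) X ->
  fun_turing_le (fun n => nat_of_bool (g n)) X ->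
  fun_turing_le (fun n => nat_of_bool (if b n then f n else g n)) X.
Proof.
move=> cb cf cg.
apply: (@turing_ext X (fun n => nat_of_bool (b n && f n || ~~ b n && g n))).
  by move=> n; case: (b n); rewrite ?orbF.
by apply: turing_or; apply: turing_and => //; apply: turing_neg.
Qed.

Lemma turing_sum X (F : nat -> nat -> nat) b :
  fun_turing_le (fun q => F (fstn q) (sndn q)) X -> fun_turing_le b X ->
  fun_turing_le (fun p => \sum_(i < b p) F p i) X.
Proof.
move=> cF cb; apply: (@turing_ext X (fun p => iteri (b p) (fun i r => r + F p i) 0)).
  by move=> p; elim: (b p) => [|k /= ->]; rewrite ?big_ord0 ?big_ord_recr.
apply: (@turing_iteri X (fun=> 0) b (fun p i r => r + F p i)) => //.
  exact: turing_const.
apply: turing_addn; first exact: turing_comp (turing_snd X) (turing_snd X).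
apply: (turing_fun2 cF); first exact: turing_fst.
exact: turing_comp (turing_fst X) (turing_snd X).
Qed.

Lemma turing_has X (P : nat -> nat -> bool) b :
  fun_turing_le (fun q => nat_of_bool (P (fstn q) (sndn q))) X -> fun_turing_le b X ->
  fun_turing_le (fun p => nat_of_bool (has (fun i => P p i) (iota 0 (b p)))) X.
Proof.
move=> cP cb.
apply: (@turing_ext X (fun p => nat_of_bool (1 <= \sum_(i < b p) P p i))).
  move=> p; congr nat_of_bool; elim: (b p) => [|k IH]; first by rewrite big_ord0.
  have -> : iota 0 k.+1 = rcons (iota 0 k) k by rewrite -addn1 iotaD cats1.
  by rewrite big_ord_recr has_rcons -IH /=; case: (P p k); lia.
apply: turing_leq; first exact: turing_const.
exact: (@turing_sum X (fun p i => nat_of_bool (P p i))).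
Qed.

Lemma turing_all X (P : nat -> nat -> bool) b :
  fun_turing_le (fun q => nat_of_bool (P (fstn q) (sndn q))) X -> fun_turing_le b X ->
  fun_turing_le (fun p => nat_of_bool (all (fun i => P p i) (iota 0 (b p)))) X.
Proof.
move=> cP cb.
apply: (@turing_ext X (fun p => nat_of_bool (~~ has (fun i => ~~ P p i) (iota 0 (b p))))).
  by move=> p; rewrite -all_predC; congr nat_of_bool; apply: eq_all => i /=; rewrite negbK.
apply: turing_neg; apply: (@turing_has X (fun p i => ~~ P p i)) => //.
exact: turing_neg.
Qed.

Lemma turing_divn X f g : fun_turing_le f X -> fun_turing_le g X ->
  fun_turing_le (fun n => f n %/ g n) X.
Proof.
move=> cf cg.
(* The quotient counts the positive multiples of [g n] up to [f n]; the conjunct [1 <= g n] matches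
   the convention that division by 0 gives 0. *)
apply: (@turing_ext X (fun n => \sum_(i < f n) ((1 <= g n) && (i.+1 * g n <= f n)))).
  move=> n; set d := g n; set m := f n; case: (posnP d) => [->|d0] /=.
    by rewrite divn0 big1.
  have sumE k : \sum_(i < k) (i.+1 * d <= m : nat) = minn k (m %/ d).
    elim: k => [|k IH]; first by rewrite big_ord0 min0n.
    by rewrite big_ord_recr /= IH -leq_divRL //; case: leqP; lia.
  by rewrite sumE; apply/minn_idPr/leq_div.
apply: (@turing_sum X (fun n i => (1 <= g n) && (i.+1 * g n <= f n) : nat)) => //.
have cg' := turing_comp cg (turing_fst X).
have cf' := turing_comp cf (turing_fst X).
apply: turing_and; apply: turing_leq => //; first exact: turing_const.
by apply: turing_muln => //; apply: turing_succ; exact: turing_snd.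
Qed.

Lemma turing_modn X f g : fun_turing_le f X -> fun_turing_le g X ->
  fun_turing_le (fun n => f n %% g n) X.
Proof.
move=> cf cg; apply: (@turing_ext X (fun n => f n - f n %/ g n * g n)).
  by move=> n; rewrite {1}(divn_eq (f n) (g n)); lia.
by apply: turing_subn => //; apply: turing_muln => //; apply: turing_divn.
Qed.

(** A number d serves both as a finite set, with x a member when digit x is 1, and as a binary
    string. *)
Definition bit (d x : nat) : bool := odd (d %/ 2 ^ x).

Lemma turing_bit X f g : fun_turing_le f X -> fun_turing_le g X ->
  fun_turing_le (fun n => nat_of_bool (bit (f n) (g n))) X.
Proof.
move=> cf cg; apply: (@turing_ext X (fun n => (f n %/ 2 ^ g n) %% 2)).
  by move=> n; rewrite modn2.
apply: turing_modn; last exact: turing_const.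
by apply: turing_divn => //; apply: turing_expn => //; exact: turing_const.
Qed.

Lemma turing_fstc X f : fun_turing_le f X -> fun_turing_le (fun n => fstn (f n)) X.
Proof. exact: (turing_comp (turing_fst X)). Qed.

Lemma turing_sndc X f : fun_turing_le f X -> fun_turing_le (fun n => sndn (f n)) X.
Proof. exact: (turing_comp (turing_snd X)). Qed.

(** [cMin] searches for the value 0, so it is applied to the negation of P, which takes the value 1
    at every failed candidate. *)
Lemma turing_min X (P : nat -> nat -> bool) m :
  fun_turing_le (fun q => nat_of_bool (P (fstn q) (sndn q))) X ->
  (forall p, P p (m p)) -> (forall p i, i < m p -> ~~ P p i) ->
  fun_turing_le m X.
Proof.
move=> /turing_neg[c cP] Pm mP; exists (cMin c) => n /=; split.
  by have := cP (pairn n (m n)); rewrite fstn_pair sndn_pair Pm.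
move=> i im; exists 0; have := cP (pairn n i).
by rewrite fstn_pair sndn_pair (negbTE (mP _ _ im)).
Qed.

Lemma ce_in_exists X (P : nat -> nat -> bool) :
  fun_turing_le (fun q => nat_of_bool (P (fstn q) (sndn q))) X ->
  ce_in X [set n | exists m, P n m].
Proof.
move=> /turing_neg[c cP]; exists (cMin c); apply/seteqP; split=> n /= [m].
  move=> Pm; case: (ex_minnP (ex_intro (P n) m Pm)) => k Pk kmin.
  exists k; split; first by have := cP (pairn n k); rewrite fstn_pair sndn_pair Pk.
  move=> i ik; exists 0; have := cP (pairn n i); rewrite fstn_pair sndn_pair.
  by case: (boolP (P n i)) => // /kmin; lia.
move=> [+ _]; have := cP (pairn n m); rewrite fstn_pair sndn_pair => h1 h2.
by have := computes_functional h1 h2; case: (boolP (P n m)) => // Pm _; exists m.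
Qed.

(** Syntax-directed use of the closure lemmas. It stops at oracles and at functions it does not
    know, leaving these as goals. *)
Ltac turing_step :=
  lazymatch goal with
  | |- fun_turing_le (fun _ => ?k) _ => exact: turing_const
  | |- fun_turing_le fstn _ => exact: turing_fst
  | |- fun_turing_le sndn _ => exact: turing_snd
  | |- fun_turing_le S ?X => exact: (turing_succ (turing_id X))
  | |- fun_turing_le (expn ?k) ?X =>
      exact: (turing_expn (turing_const X k) (turing_id X))
  | |- fun_turing_le (fun p => p) _ => exact: turing_id
  | |- fun_turing_le (fun p => pairn _ _) _ => apply: turing_pair
  | |- fun_turing_le (fun p => fstn _) _ => apply: turing_fstc
  | |- fun_turing_le (fun p => sndn _) _ => apply: turing_sndc
  | |- fun_turing_le (fun p => S _) _ => apply: turing_succ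
  | |- fun_turing_le (fun p => predn _) _ => apply: turing_pred
  | |- fun_turing_le (fun p => addn _ _) _ => apply: turing_addn
  | |- fun_turing_le (fun p => subn _ _) _ => apply: turing_subn
  | |- fun_turing_le (fun p => muln _ _) _ => apply: turing_muln
  | |- fun_turing_le (fun p => expn _ _) _ => apply: turing_expn
  | |- fun_turing_le (fun p => divn _ _) _ => apply: turing_divn
  | |- fun_turing_le (fun p => modn _ _) _ => apply: turing_modn
  | |- fun_turing_le (fun p => nat_of_bool (bit _ _)) _ => apply: turing_bit
  | |- fun_turing_le (fun p => nat_of_bool (leq _ _)) _ => apply: turing_leq
  | |- fun_turing_le (fun p => nat_of_bool (andb _ _)) _ => apply: turing_and
  | |- fun_turing_le (fun p => nat_of_bool (orb _ _)) _ => apply: turing_or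
  | |- fun_turing_le (fun p => nat_of_bool (implb _ _)) _ => apply: turing_imply
  | |- fun_turing_le (fun p => nat_of_bool (negb _)) _ => apply: turing_neg
  | |- fun_turing_le (fun p => nat_of_bool (eq_op _ _)) _ =>
      first [apply: turing_eqn | apply: turing_eqb]
  | |- fun_turing_le (fun p => nat_of_bool (has (fun i => @?P p i) (iota 0 (@?b p)))) ?X =>
      apply: (@turing_has X P b)
  | |- fun_turing_le (fun p => nat_of_bool (all (fun i => @?P p i) (iota 0 (@?b p)))) ?X =>
      apply: (@turing_all X P b)
  | |- fun_turing_le (fun p => nat_of_bool (if _ then _ else _)) ?X =>
      apply: turing_ifb
  end.
Ltac turing := repeat (turing_step; cbv beta).

(** * Halting within a bound, and the approximation of 0' *)

Lemma hasP_iota (P : pred nat) k :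
  reflect (exists2 i, i < k & P i) (has P (iota 0 k)).
Proof.
by apply: (iffP hasP) => -[i ik Pi]; exists i => //; move: ik; rewrite mem_iota.
Qed.

Lemma allP_iota (P : pred nat) k :
  reflect (forall i, i < k -> P i) (all P (iota 0 k)).
Proof.
apply: (iffP allP) => H i ik; first by apply: H; rewrite mem_iota.
by apply: H; rewrite mem_iota in ik.
Qed.

(** This bounds every search through the finite set coded by d by d itself. *)
Lemma bit_lt d x : bit d x -> x < d.
Proof.
rewrite /bit => h; apply: (leq_trans (ltn_expl x (isT : 1 < 2))).
by case: leqP => // /divn_small dx; rewrite dx in h.
Qed.

Lemma bit_add_expn d B x : d < 2 ^ B -> bit (d + 2 ^ B) x = bit d x || (x == B).
Proof.
move=> dB; rewrite /bit; case: (ltngtP x B) => xB.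
- have -> : 2 ^ B = 2 ^ (B - x) * 2 ^ x by rewrite -expnD subnK // ltnW.
  rewrite addnC divnMDl ?expn_gt0 // oddD oddX /=.
  have -> : (B - x == 0) = false by lia.
  by case: odd.
- have h : 2 ^ B.+1 <= 2 ^ x by rewrite leq_exp2l.
  by rewrite !divn_small //; rewrite expnS in h; lia.
- by rewrite xB divnDr ?dvdnn // divnn expn_gt0 /= divn_small // orbT.
Qed.

Lemma bit_pred (P : pred nat) B :
  exists2 d, d < 2 ^ B & forall x, bit d x = (x < B) && P x.
Proof.
elim: B => [|B [d dB dP]].
  by exists 0 => // x; rewrite /bit div0n ltn0.
have [PB|PB] := boolP (P B).
  exists (d + 2 ^ B); first by rewrite expnS; lia.
  move=> x; rewrite bit_add_expn // dP ltnS [x <= B]leq_eqVlt.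
  by case: (eqVneq x B) => [->|_] /=; rewrite ?PB ?orbT ?orbF.
exists d; first by rewrite expnS; lia.
move=> x; rewrite dP ltnS [x <= B]leq_eqVlt.
by case: (eqVneq x B) => [->|_] //=; rewrite (negbTE PB) ltnn.
Qed.

Definition claim (e n m : nat) : nat := pairn e (pairn n m).

Lemma leq_claim e n m : e + n + m <= claim e n m.
Proof. by have := leq_pairn e (pairn n m); have := leq_pairn n m; rewrite /claim; lia. Qed.

(* A finite set of claims "program number e halts on n with output m" is the
   set of binary digits of a number d. Each claim needs to be justified by the
   other ones only one step down; as the programs get smaller (or, for [cPrec],
   the recursion argument does), no circularity can occur. *)
Definition justified (X : nat -> bool) (d e n m : nat) : bool :=
  let q := (e - 5) %/ 4 in let r := (e - 5) %% 4 in
  [|| (e == 0) && (m == 0), (e == 1) && (m == n.+1), (e == 2) && (m == fstn n),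
      (e == 3) && (m == sndn n), (e == 4) && (m == nat_of_bool (X n))
    | (4 < e) && [|| (r == 0) && has (fun u => has (fun v =>
          [&& bit d (claim (fstn q) n u), bit d (claim (sndn q) n v)
            & m == pairn u v]) (iota 0 d)) (iota 0 d),
        (r == 1) && has (fun u =>
          bit d (claim (sndn q) n u) && bit d (claim (fstn q) u m)) (iota 0 d),
        (r == 2) && (if sndn n == 0 then bit d (claim (fstn q) (fstn n) m)
          else has (fun u =>
            bit d (claim e (pairn (fstn n) (sndn n).-1) u) &&
            bit d (claim (sndn q) (pairn (fstn n) (pairn (sndn n).-1 u)) m))
            (iota 0 d))
      | (r == 3) && (bit d (claim q (pairn n m) 0) &&
          all (fun i => has (fun k => bit d (claim q (pairn n i) k.+1)) (iota 0 d))
            (iota 0 m))]].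

Definition valid (X : nat -> bool) (d : nat) : bool :=
  all (fun x => bit d x ==>
    justified X d (fstn x) (fstn (sndn x)) (sndn (sndn x))) (iota 0 d).

(** The same condition read off the syntax of programs, with unbounded quantifiers and an arbitrary
    set D of claims; in this form it is visibly monotone in D. *)
Definition justified_code (X : nat -> bool) (D : nat -> bool) c n m : Prop :=
  match c with
  | cZero => m = 0
  | cSucc => m = n.+1
  | cFst => m = fstn n
  | cSnd => m = sndn n
  | cOracle => m = nat_of_bool (X n)
  | cPair a b => exists u v, [/\ D (claim (code_index a) n u),
      D (claim (code_index b) n v) & m = pairn u v]
  | cComp a b => exists u,
      D (claim (code_index b) n u) /\ D (claim (code_index a) u m)
  | cPrec a b => if sndn n is y.+1 then
        exists u, D (claim (code_index (cPrec a b)) (pairn (fstn n) y) u) /\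
          D (claim (code_index b) (pairn (fstn n) (pairn y u)) m)
      else D (claim (code_index a) (fstn n) m)
  | cMin a => D (claim (code_index a) (pairn n m) 0) /\
      forall i, i < m -> exists k, D (claim (code_index a) (pairn n i) k.+1)
  end.

Lemma claim_lt d e n m : bit d (claim e n m) -> [/\ e < d, n < d & m < d].
Proof. by move=> /bit_lt; have := leq_claim e n m; split; lia. Qed.

(** Quotient and remainder by 4 recover the subprograms and the constructor from [code_index]. The
    bounds on the searches lose nothing, as all components of a claim in d are below d. *)
Lemma justifiedP X d c n m :
  justified X d (code_index c) n m <-> justified_code X (bit d) c n m.
Proof.
have D r N : r < 4 -> (5 + r + 4 * N - 5) %/ 4 = N by lia.
have M r N : r < 4 -> (5 + r + 4 * N - 5) %% 4 = r by lia.
case: c => [|||||a b|a b|a b|a]; rewrite /justified.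
1-5: by rewrite /= ?orbF; split=> /eqP.
- rewrite (D 0) // (M 0) //= fstn_pair sndn_pair orbF; split.
    by case/hasP_iota => u _ /hasP_iota[v _ /and3P[h1 h2 /eqP ->]]; exists u, v.
  move=> [u [v [h1 h2 ->]]]; apply/hasP_iota; exists u; first by case: (claim_lt h1).
  by apply/hasP_iota; exists v; [case: (claim_lt h2)|rewrite h1 h2 eqxx].
- rewrite (D 1) // (M 1) //= fstn_pair sndn_pair orbF; split.
    by case/hasP_iota => u _ /andP[]; exists u.
  move=> [u [h1 h2]]; apply/hasP_iota; exists u; first by case: (claim_lt h1).
  by rewrite h1.
- rewrite (D 2) // (M 2) //= fstn_pair sndn_pair orbF.
  case: (sndn n) => [|y] //=; split.
    by case/hasP_iota => u _ /andP[]; exists u.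
  move=> [u [h1 h2]]; apply/hasP_iota; exists u; first by case: (claim_lt h1).
  by rewrite h1.
- rewrite (D 3) // (M 3) //=; split.
    move=> /andP[-> /allP_iota H]; split=> // i /H /hasP_iota[k _ h]; by exists k.
  move=> [-> H]; apply/allP_iota => i /H[k h]; apply/hasP_iota; exists k => //.
  by case: (claim_lt h) => _ _; lia.
Qed.

Lemma validP X d : valid X d <->
  forall c n m, bit d (claim (code_index c) n m) -> justified_code X (bit d) c n m.
Proof.
split=> [/allP_iota V c n m h|V].
  have := V _ (bit_lt h); rewrite h /claim !(fstn_pair, sndn_pair) /=.
  by move/justifiedP.
apply/allP_iota => x xd; apply/implyP.
rewrite -{1}[x]pairn_eta -[sndn x]pairn_eta -/(claim _ _ _).
have [c <-] := code_index_surj (fstn x).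
by rewrite !(fstn_pair, sndn_pair) => h; apply/justifiedP/V.
Qed.

Lemma justified_code_mono X (D D' : nat -> bool) c n m :
  (forall x, D x -> D' x) -> justified_code X D c n m -> justified_code X D' c n m.
Proof.
move=> DD'; case: c => [|||||a b|a b|a b|a] //=.
- by move=> [u [v [/DD' h1 /DD' h2 h3]]]; exists u, v.
- by move=> [u [/DD' h1 /DD' h2]]; exists u.
- by case: (sndn n) => [|y]; [exact: DD'|move=> [u [/DD' h1 /DD' h2]]; exists u].
- by move=> [/DD' h1 h2]; split=> // i /h2[k /DD' h]; exists k.
Qed.

(** Soundness of certificates, by induction on the program. *)
Lemma valid_computes X d c n m :
  valid X d -> bit d (claim (code_index c) n m) -> computes X c n m.
Proof.
move/validP => V; elim: c n m => [|||||a IHa b IHb|a IHa b IHb|a IHa b IHb|a IHa] n m h;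
  have := V _ _ _ h => //=.
- by move=> [u [v [/IHa h1 /IHb h2 h3]]]; exists u, v.
- by move=> [u [/IHb h1 /IHa h2]]; exists u.
(* A [cPrec] claim may rest on another claim for the same program with a smaller recursion argument,
   so the input is split as (x, y) for an inner induction on y. *)
- move=> _; rewrite -(pairn_eta n) in h; move: h; rewrite -{2 3 4}(pairn_eta n).
  rewrite !(fstn_pair, sndn_pair); move: (fstn n) (sndn n) => x y {n}.
  elim: y m => [|y IH] m h; have := V _ _ _ h => /=; rewrite !(fstn_pair, sndn_pair).
    by move/IHa => h'; exists (fun=> m); split=> // i; rewrite ltn0.
  move=> [u [/IH[k [k0 kS uE]] /IHb h']].
  exists (fun i => if i <= y then k i else m); split => //=; last by rewrite ltnn.
  move=> i; rewrite ltnS leq_eqVlt => /orP[/eqP ->|iy].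
    by rewrite eqxx ltnn -uE.
  by rewrite iy orbT; apply: kS.
- move=> [/IHa h1 h2]; split=> // i /h2[k /IHa h3]; by exists k.
Qed.

Lemma valid_union X d1 d2 : valid X d1 -> valid X d2 ->
  exists2 d, valid X d & forall x, bit d x = bit d1 x || bit d2 x.
Proof.
move=> /validP V1 /validP V2.
have [d _ dE] := bit_pred (fun x => bit d1 x || bit d2 x) (d1 + d2).
have {}dE x : bit d x = bit d1 x || bit d2 x.
  rewrite dE andb_idl // => /orP[] /bit_lt; lia.
exists d => //; apply/validP => c n m; rewrite dE => /orP[/V1|/V2];
  by apply: justified_code_mono => x h; rewrite dE h ?orbT.
Qed.

Lemma valid_bigunion X k (F : nat -> nat) :
  (forall i, i < k -> exists2 d, valid X d & bit d (F i)) ->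
  exists2 d, valid X d & forall i, i < k -> bit d (F i).
Proof.
elim: k => [|k IH] H; first by exists 0.
have [d1 V1 h1] := IH (fun i ik => H i (leq_trans ik (leqnSn k))).
have [d2 V2 h2] := H k (leqnn _).
have [d V dE] := valid_union V1 V2; exists d => // i.
by rewrite ltnS leq_eqVlt dE => /orP[/eqP ->|/h1 ->]; rewrite ?h2 ?orbT.
Qed.

Lemma valid_add X d c n m : valid X d -> justified_code X (bit d) c n m ->
  exists2 d', valid X d' & bit d' (claim (code_index c) n m).
Proof.
move=> /validP V J; set k := claim _ _ _.
have [d' _ dE] := bit_pred (fun x => bit d x || (x == k)) (d + k.+1).
have {}dE x : bit d' x = bit d x || (x == k).
  by rewrite dE andb_idl // => /orP[/bit_lt|/eqP ->]; lia.
exists d'; last by rewrite dE eqxx orbT.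
apply/validP => c' n' m'; rewrite dE => h.
apply: (@justified_code_mono X (bit d)); first by move=> x hx; rewrite dE hx.
case/orP: h => [/V //|/eqP /pairn_inj[/code_index_inj -> /pairn_inj[-> ->]]].
exact: J.
Qed.

(** Completeness of certificates: those of the subcomputations are united, and the claim they
    justify is added. *)
Lemma computes_valid X c n m : computes X c n m ->
  exists2 d, valid X d & bit d (claim (code_index c) n m).
Proof.
elim: c n m => [|||||a IHa b IHb|a IHa b IHb|a IHa b IHb|a IHa] n m.
1-5: by move=> h; apply: (@valid_add X 0).
- move=> [u [v [/IHa[d1 V1 h1] /IHb[d2 V2 h2] mE]]].
  have [d V dE] := valid_union V1 V2; apply: (valid_add V) => /=.
  by exists u, v; rewrite !dE h1 h2 orbT.
- move=> [u /IHb[d1 V1 h1] /IHa[d2 V2 h2]].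
  have [d V dE] := valid_union V1 V2; apply: (valid_add V) => /=.
  by exists u; rewrite !dE h1 h2 orbT.
- move=> [h [h0 hS ->]]; rewrite -{1}(pairn_eta n).
  (* The recursion argument is generalized to any y up to [sndn n], to certify the values h 0, h 1,
     ... in turn. *)
  have := leqnn (sndn n); move: {1 3 4}(sndn n) => y yn.
  elim: y yn => [|y IH] yn.
    have [d V hd] := IHa _ _ h0; apply: (valid_add V) => /=.
    by rewrite sndn_pair fstn_pair.
  have [d1 V1 h1] := IH (ltnW yn); have [d2 V2 h2] := IHb _ _ (hS _ yn).
  have [d V dE] := valid_union V1 V2; apply: (valid_add V).
  rewrite /justified_code sndn_pair fstn_pair.
  by exists (h y); rewrite !dE h1 h2 orbT.
- move=> [/IHa[d1 V1 h1] h].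
  have /choice[k hk] i : exists k, i < m -> computes X a (pairn n i) k.+1.
    by case: (ltnP i m) => [/h[k]|_]; [exists k|exists 0].
  have [i im|d2 V2 h2] :=
    @valid_bigunion X m (fun i => claim (code_index a) (pairn n i) (k i).+1).
    exact/IHa/hk.
  have [d V dE] := valid_union V1 V2; apply: (valid_add V) => /=.
  split; first by rewrite dE h1.
  by move=> i im; exists (k i); rewrite dE h2 // orbT.
Qed.

Lemma valid_local X Y d : (forall n, n < d -> X n = Y n) -> valid X d = valid Y d.
Proof.
move=> XY.
suff H X' Y' : (forall n, n < d -> X' n = Y' n) -> valid X' d -> valid Y' d.
  by apply/idP/idP; apply: H => n nd; rewrite XY.
move=> {}XY /validP V; apply/validP => c n m h; have := V _ _ _ h.
by case: c h => // /claim_lt[_ nd _] /=; rewrite XY.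
Qed.

(** The bound s is on the certificate instead of on running time. This is decidable, monotone in s,
    and consults the oracle only below s. *)
Definition halts_within (X : nat -> bool) (e n s : nat) : bool :=
  has (fun d => valid X d && has (fun m => bit d (claim e n m)) (iota 0 d))
    (iota 0 s.+1).

Lemma halts_within_mono X e n s s' :
  s <= s' -> halts_within X e n s -> halts_within X e n s'.
Proof.
move=> ss' /hasP_iota[d ds h]; apply/hasP_iota; exists d => //; lia.
Qed.

Lemma halts_withinP X c n :
  (exists m, computes X c n m) <-> (exists s, halts_within X (code_index c) n s).
Proof.
split=> [[m /computes_valid[d V h]]|[s /hasP_iota[d _ /andP[V /hasP_iota[m _ h]]]]].
  exists d; apply/hasP_iota; exists d => //; rewrite V /=.
  by apply/hasP_iota; exists m => //; case: (claim_lt h).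
by exists m; apply: valid_computes V h.
Qed.

Lemma halts_within_local X Y e n s : (forall i, i < s -> X i = Y i) ->
  halts_within X e n s = halts_within Y e n s.
Proof.
move=> XY; rewrite /halts_within; apply: eq_in_has => d; rewrite mem_iota => ds.
congr andb; apply: valid_local => i id; apply: XY; lia.
Qed.

Lemma turing_halts_within Z (X : nat -> nat -> bool) (v e n s : nat -> nat) :
  fun_turing_le (fun q => nat_of_bool (X (fstn q) (sndn q))) Z ->
  fun_turing_le v Z -> fun_turing_le e Z -> fun_turing_le n Z -> fun_turing_le s Z ->
  fun_turing_le (fun p => nat_of_bool (halts_within (X (v p)) (e p) (n p) (s p))) Z.
Proof.
move=> cX cv ce cn cs.
have cV : fun_turing_le (fun q => nat_of_bool (valid (X (fstn q)) (sndn q))) Z.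
  rewrite /valid /justified /claim; turing; apply: (@turing_bool2 Z X) => //; turing.
rewrite /halts_within /claim; turing.
  apply: (@turing_bool2 Z (fun v d => valid (X v) d)) => //; turing.
  exact: turing_comp cv (turing_fst Z).
  exact: turing_comp ce (turing_fstc (turing_fst Z)).
  exact: turing_comp cn (turing_fstc (turing_fst Z)).
exact: cs.
Qed.

Definition zero_jump_stage (v n : nat) : bool := halts_within (fun=> false) n n v.

(** Each number below k either enters at some stage and stays, or never enters; u is the largest of
    the finitely many entry stages. *)
Lemma zero_jump_stage_limit k :
  exists u, forall v, u <= v -> forall n, n < k -> zero_jump_stage v n = zero_jump n.
Proof.
elim: k => [|k [u hu]]; first by exists 0.
have [c ck] := code_index_surj k.
have [kJ|kJ] := pselect (exists s, zero_jump_stage s k).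
  have [s sk] := kJ; exists (maxn u s) => v; rewrite geq_max => /andP[uv sv] n.
  rewrite ltnS leq_eqVlt => /orP[/eqP ->|/hu -> //].
  rewrite [LHS](halts_within_mono sv sk); apply/esym/asboolP; exists c => //.
  by apply/halts_withinP; exists s; rewrite ck.
exists u => v uv n; rewrite ltnS leq_eqVlt => /orP[/eqP ->|/hu -> //].
have /negbTE -> : ~~ zero_jump_stage v k by apply/negP => h; apply: kJ; exists v.
apply/esym/asboolP => -[c' c'k]; rewrite -{}c'k in kJ *.
by move/halts_withinP.
Qed.

Lemma turing_zero_jump_stage Z (v n : nat -> nat) :
  fun_turing_le v Z -> fun_turing_le n Z ->
  fun_turing_le (fun p => nat_of_bool (zero_jump_stage (v p) (n p))) Z.
Proof.
move=> cv cn; rewrite /zero_jump_stage.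
by apply: (@turing_halts_within Z (fun _ _ => false) (fun p => p)) => //; turing.
Qed.

(** * The measure of events depending on a prefix *)

(* The string X 0 .. X (s-1), coded by its length s and the number below 2^s with
   these binary digits, the first bit being the lowest digit. *)
Definition prefix_num (X : nat -> bool) (s : nat) : nat := \sum_(i < s) X i * 2 ^ i.

Lemma prefix_numS X s : prefix_num X s.+1 = prefix_num X s + X s * 2 ^ s.
Proof. by rewrite /prefix_num big_ord_recr. Qed.

Lemma prefix_num_lt X s : prefix_num X s < 2 ^ s.
Proof.
elim: s => [|s IH]; first by rewrite /prefix_num big_ord0.
by rewrite prefix_numS expnS; case: (X s); lia.
Qed.

(** As the first bit is the lowest digit, truncating a string is reduction modulo a power of 2. *)
Lemma prefix_num_mod X s j : j <= s -> prefix_num X s %% 2 ^ j = prefix_num X j.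
Proof.
elim: s => [|s IH] js.
  by move: js; rewrite leqn0 => /eqP ->; rewrite modn_small ?prefix_num_lt.
have [->|js'] : j = s.+1 \/ j <= s by lia.
  by rewrite modn_small ?prefix_num_lt.
rewrite prefix_numS -(subnK js') expnD mulnA addnC modnMDl subnK //; exact: IH.
Qed.

Lemma modn_bit t i : t %% 2 ^ i.+1 = t %% 2 ^ i + bit t i * 2 ^ i.
Proof.
rewrite /bit -modn2 {1}(divn_eq t (2 ^ i)) {1}(divn_eq (t %/ 2 ^ i) 2).
set q := _ %/ 2; set r := _ %% 2.
have -> : (q * 2 + r) * 2 ^ i + t %% 2 ^ i = q * 2 ^ i.+1 + (t %% 2 ^ i + r * 2 ^ i).
  by rewrite expnS; lia.
rewrite modnMDl modn_small // expnS.
have : t %% 2 ^ i < 2 ^ i by rewrite ltn_mod expn_gt0.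
have : r < 2 by rewrite ltn_mod.
by case: r => [|[|]] // _; lia.
Qed.

Lemma prefix_num_bit t s : prefix_num (bit t) s = t %% 2 ^ s.
Proof.
elim: s => [|s IH]; first by rewrite /prefix_num big_ord0 modn1.
by rewrite prefix_numS IH modn_bit.
Qed.

(** [str_index] is binary notation with digits 1 and 2 in place of 0 and 1; the s extra units
    contribute 2 ^ s - 1. *)
Lemma str_index_mkseq X s : str_index (mkseq X s) = 2 ^ s - 1 + prefix_num X s.
Proof.
elim: s X => [|s IH] X; first by rewrite /prefix_num big_ord0.
have -> : mkseq X s.+1 = X 0 :: mkseq (X \o succn) s.
  by rewrite /mkseq /= -[1]/(1 + 0) iotaDl -map_comp.
rewrite /= -/(str_index _) IH /prefix_num big_ord_recl /= muln1.
under [in RHS]eq_bigr => i _ do rewrite expnS mulnCA.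
rewrite -big_distrr expnS /=.
have : 0 < 2 ^ s by rewrite expn_gt0.
by rewrite /bump /= /addn /=; lia.
Qed.

Lemma cylinderP (sigma : seq bool) (X : nat -> bool) : cylinder sigma X <->
  str_index sigma = 2 ^ size sigma - 1 + prefix_num X (size sigma).
Proof.
rewrite -str_index_mkseq; split; first by move=> /= ->.
by move/(bij_inj str_index_bij) => e; rewrite /cylinder /= -e.
Qed.

Lemma cylinder_bit t s : t < 2 ^ s ->
  cylinder (mkseq (bit t) s) = [set X | prefix_num X s = t].
Proof.
move=> ts; apply/predeqP => X; rewrite cylinderP str_index_mkseq size_mkseq.
by rewrite prefix_num_bit modn_small //=; split=> [/addnI|] ->.
Qed.

Lemma measurable_prefix_num t s :
  measurable ([set X | prefix_num X s = t] : set cantor_set).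
Proof.
have [ts|ts] := ltnP t (2 ^ s).
  by rewrite -cylinder_bit //; apply: sub_sigma_algebra; exists (mkseq (bit t) s).
rewrite (_ : mkset _ = set0) //; apply/seteqP; split=> // X /= e.
by have := prefix_num_lt X s; rewrite e ltnNge ts.
Qed.

Lemma prefix_event_bigsetU (p : pred nat) s :
  [set X : cantor_set | p (prefix_num X s)] =
  \big[setU/set0]_(t < 2 ^ s) [set X : cantor_set | prefix_num X s = t /\ p t].
Proof.
rewrite -(bigcup_mkord _ (fun t => [set X : cantor_set | prefix_num X s = t /\ p t])).
apply/seteqP; split=> X /=; last by move=> [t _ [-> ]].
by move=> h; exists (prefix_num X s) => //=; exact: prefix_num_lt.
Qed.

Lemma measurable_prefix_num_and (p : pred nat) t s :
  measurable ([set X | prefix_num X s = t /\ p t] : set cantor_set).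
Proof.
case: (boolP (p t)) => pt; last first.
  by rewrite (_ : mkset _ = set0) //; apply/seteqP; split=> // X /= [].
rewrite (_ : mkset _ = [set X | prefix_num X s = t]); first exact: measurable_prefix_num.
by apply/seteqP; split=> X /= => [[]|].
Qed.

Lemma measurable_prefix_event (p : pred nat) s :
  measurable ([set X | p (prefix_num X s)] : set cantor_set).
Proof.
rewrite prefix_event_bigsetU; apply: bigsetU_measurable => t _.
exact: measurable_prefix_num_and.
Qed.

Lemma fair_coin_prefix_event (R : realType) (p : pred nat) s :
  fair_coin R [set X : cantor_set | p (prefix_num X s)] =
  ((\sum_(t < 2 ^ s) p t)%:R * 2^-1 ^+ s)%:E%R.
Proof.
pose F t : set cantor_set := [set X | prefix_num X s = t /\ p t].
have mF t : measurable (F t) by exact: measurable_prefix_num_and.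
have tF : trivIset setT F by move=> t t' _ _ [X /= [[<- _] [<- _]]].
rewrite prefix_event_bigsetU.
transitivity (\sum_(t < 2 ^ s) fair_coin R (F t))%E.
  exact: (@measure_bigsetU _ _ _ (fair_coin R) F mF tF).
rewrite natr_sum mulr_suml -sumEFin; apply: eq_bigr => t _.
case: (boolP (p t)) => pt; last first.
  rewrite (_ : F t = set0) ?measure0 ?mul0r //.
  by apply/seteqP; split=> // X; rewrite /F /= => -[_]; exact/negP.
rewrite (_ : F t = cylinder (mkseq (bit t) s)) ?fair_coin_cylinder ?size_mkseq ?mul1r //.
by rewrite cylinder_bit // /F; apply/seteqP; split=> X /= => [[]|].
Qed.

(** Continuity from below, applied to the finite partial unions. *)
Lemma measure_bigcup_le (R : realType) (B : nat -> set cantor_set) (c : \bar R) :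
  (forall i, measurable (B i)) ->
  (forall n, fair_coin R (\big[setU/set0]_(i < n) B i) <= c)%E ->
  (fair_coin R (\bigcup_i B i) <= c)%E.
Proof.
move=> mB Bc; rewrite -bigcup_bigsetU_bigcup.
have mF n : measurable (\big[setU/set0]_(i < n.+1) B i) by exact: bigsetU_measurable.
have cv := @nondecreasing_cvg_mu _ _ _ (fair_coin R) _ mF (bigcupT_measurable _ mF).
rewrite -(cvg_lim _ (cv _)) //; last first.
  by move=> n m nm; apply/subsetPset/subset_bigsetU.
apply: lime_le; last by apply: nearW => n; exact: Bc.
apply/cvg_ex; eexists; apply: cv => n m nm; exact/subsetPset/subset_bigsetU.
Qed.

(** * A universal test relative to 0' *)

(* The string t of length s has a prefix in the stage s approximation of the n-th
   member of the e-th uniformly Sigma_1 family relative to X; 2^j - 1 + t %% 2^j is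
   the [str_index] of the prefix of length j. *)
Definition covered (X : nat -> bool) (e n s t : nat) : bool :=
  has (fun j => halts_within X e (pairn n (2 ^ j - 1 + t %% 2 ^ j)) s) (iota 0 s.+1).

(* Approximations are kept only as long as their measure is at most 2^-(e+2), so
   that the sets captured for some e have total measure at most 1/2, whether or
   not the e-th family is a test. *)
Definition captured (X : nat -> bool) (e s t : nat) : bool :=
  covered X e e.+2 s t &&
  ((\sum_(u < 2 ^ s) covered X e e.+2 s u) * 2 ^ e.+2 <= 2 ^ s).

Lemma coveredP X e n s Y : covered X e n s (prefix_num Y s) <->
  exists2 j, j <= s & halts_within X e (pairn n (2 ^ j - 1 + prefix_num Y j)) s.
Proof.
split=> [/hasP_iota[j js h]|[j js h]]; last apply/hasP_iota; exists j => //.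
  by rewrite prefix_num_mod in h.
by rewrite prefix_num_mod.
Qed.

Lemma covered_mono X e n s s' Y : s <= s' ->
  covered X e n s (prefix_num Y s) -> covered X e n s' (prefix_num Y s').
Proof.
move=> ss' /coveredP[j js h]; apply/coveredP; exists j; first exact: leq_trans ss'.
exact: halts_within_mono h.
Qed.

Lemma covered_local X Y e n s t : (forall i, i < s -> X i = Y i) ->
  covered X e n s t = covered Y e n s t.
Proof. by move=> XY; apply: eq_has => j; exact: halts_within_local. Qed.

Lemma captured_local X Y e s t : (forall i, i < s -> X i = Y i) ->
  captured X e s t = captured Y e s t.
Proof.
move=> XY; rewrite /captured (covered_local _ _ _ XY); congr (_ && (_ * _ <= _)).
by apply: eq_bigr => u _; rewrite (covered_local _ _ _ XY).
Qed.

Lemma turing_captured Z (v e s t : nat -> nat) :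
  fun_turing_le v Z -> fun_turing_le e Z -> fun_turing_le s Z -> fun_turing_le t Z ->
  fun_turing_le (fun p =>
    nat_of_bool (captured (zero_jump_stage (v p)) (e p) (s p) (t p))) Z.
Proof.
move=> cv ce cs ct.
suff H : fun_turing_le (fun q => nat_of_bool (captured
    (zero_jump_stage (fstn q)) (fstn (sndn q))
    (fstn (sndn (sndn q))) (sndn (sndn (sndn q))))) Z.
  have := turing_comp H (turing_pair cv (turing_pair ce (turing_pair cs ct))).
  by apply: turing_ext => n; rewrite !(fstn_pair, sndn_pair).
(* [covered] occurs in [captured] twice, on the given string and inside the counting sum; b extracts
   the parameters in either context. *)
have H (b u : nat -> nat) : fun_turing_le b Z -> fun_turing_le u Z ->
    fun_turing_le (fun q => nat_of_bool (covered (zero_jump_stage (fstn (b q)))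
      (fstn (sndn (b q))) (fstn (sndn (b q))).+2 (fstn (sndn (sndn (b q)))) (u q))) Z.
  move=> cb cu; rewrite /covered; turing; last exact: cb.
  apply: (@turing_halts_within Z zero_jump_stage); turing;
    do ?[exact: turing_comp cb (turing_fst Z)|exact: turing_comp cu (turing_fst Z)].
  by apply: turing_zero_jump_stage; turing; exact: turing_comp cb (turing_fst Z).
rewrite /captured; turing.
  by apply: H; turing.
apply: (@turing_sum Z (fun q u => nat_of_bool (covered (zero_jump_stage (fstn q))
      (fstn (sndn q)) (fstn (sndn q)).+2 (fstn (sndn (sndn q))) u))); turing.
by apply: H; turing.
Qed.

Section captured_sets.
Variable R : realType.
Local Notation mu := (fair_coin R).

Definition captured_set (e s : nat) : set cantor_set :=
  [set X | captured zero_jump e s (prefix_num X s)].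

Lemma measurable_captured_set e s : measurable (captured_set e s).
Proof. exact: measurable_prefix_event. Qed.

Definition covered_set (e s : nat) : set cantor_set :=
  [set X | covered zero_jump e e.+2 s (prefix_num X s)].

Lemma measurable_covered_set e s : measurable (covered_set e s).
Proof. exact: measurable_prefix_event. Qed.

(** The counting test in [captured] is this measure bound cleared of denominators. *)
Lemma covered_set_small e s : (mu (covered_set e s) <= (2^-1 ^+ e.+2)%:E)%E%R =
  ((\sum_(u < 2 ^ s) covered zero_jump e e.+2 s u) * 2 ^ e.+2 <= 2 ^ s).
Proof.
rewrite /covered_set fair_coin_prefix_event lee_fin.
rewrite !exprVn ler_pdivrMr ?exprn_gt0 // mulrC ler_pdivlMr ?exprn_gt0 //.
by rewrite -!natrX -natrM ler_nat.
Qed.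

Lemma captured_set_small e s X : captured_set e s X ->
  covered_set e s X /\ (mu (covered_set e s) <= (2^-1 ^+ e.+2)%:E)%E%R.
Proof. by rewrite covered_set_small => /andP[]. Qed.

(** The sets [covered_set e s] increase with s. If stage n passes the size test, [covered_set e n]
    is small and contains everything captured up to n; if it fails, stage n captures nothing. *)
Lemma measure_bigcup_captured_set e :
  (mu (\bigcup_s captured_set e s) <= (2^-1 ^+ e.+2)%:E)%E%R.
Proof.
apply: measure_bigcup_le => [s|n]; first exact: measurable_captured_set.
have mU k : measurable (\big[setU/set0]_(s < k) captured_set e s).
  by apply: bigsetU_measurable => s _; exact: measurable_captured_set.
elim: n => [|n IH]; first by rewrite big_ord0 measure0 lee_fin exprn_ge0.
have [h|h] := boolP (mu (covered_set e n) <= (2^-1 ^+ e.+2)%:E)%E%R.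
  apply: le_trans h; apply: le_measure; rewrite ?inE //.
    exact: measurable_covered_set.
  move=> X; rewrite -bigcup_mkord => -[s /= sn /captured_set_small[h _]].
  by apply: covered_mono h.
rewrite big_ord_recr /= (_ : captured_set e n = set0) ?setU0 //.
by apply/seteqP; split=> // X /captured_set_small[_]; rewrite (negbTE h).
Qed.

Lemma measure_captured :
  (mu (\bigcup_e \bigcup_s captured_set e s) <= (2^-1)%:E)%E%R.
Proof.
have mB e : measurable (\bigcup_s captured_set e s).
  by apply: bigcupT_measurable => s; exact: measurable_captured_set.
apply: measure_bigcup_le => // n.
(* The bound is the sum of 2^-(e+2) over e < n. *)
suff H : (mu (\big[setU/set0]_(e < n) \bigcup_s captured_set e s) <=
    (2^-1 - 2^-1 ^+ n.+1)%:E)%E%R.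
  by apply: (le_trans H); rewrite lee_fin lerBlDr lerDl exprn_ge0.
elim: n => [|n IH]; first by rewrite big_ord0 measure0 expr1 subrr.
rewrite big_ord_recr /=; apply: (le_trans (@measureU2 _ _ _ mu _ _ _ _)) => //.
  by apply: bigsetU_measurable => e _; exact: mB.
apply: (le_trans (leeD IH (measure_bigcup_captured_set n))).
rewrite -EFinD lee_fin ![(_ ^+ n.+2)%R]exprS; set x := (_ ^+ n.+1)%R.
by lra.
Qed.

(** If e is the index of the enumeration of U, the approximations to U (e+2) lie inside a set of
    measure at most 2^-(e+2), so a genuine test is never trimmed. *)
Lemma captured_test U (Z : cantor_set) : ML_test R zero_jump U -> (\bigcap_n U n) Z ->
  exists e s, captured_set e s Z.
Proof.
move=> [[W [c WE] UE] muU] ZU; set e := code_index c; exists e.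
have := ZU e.+2 I; rewrite UE => -[sigma]; rewrite /= WE => /= /halts_withinP[d h].
move=> /cylinderP sE; rewrite sE in h; set j := size sigma in h.
(* Stage d lets the computation halt, and stage j admits prefixes of length j. *)
exists (maxn d j); apply/andP; split.
  apply/coveredP; exists j; rewrite ?leq_maxr //.
  exact: halts_within_mono (leq_maxl _ _) h.
rewrite -covered_set_small; apply: le_trans (muU e.+2); apply: le_measure.
- by rewrite inE; exact: measurable_covered_set.
- rewrite inE UE bigcup_mkcond; apply: countable_bigcupT_measurable => // s.
  by case: ifP => // _; apply: sub_sigma_algebra; exists s.
move=> X /coveredP[k _ hk]; rewrite UE; exists (mkseq X k).
  rewrite /= WE str_index_mkseq /=; apply/halts_withinP; by exists (maxn d j).
by rewrite /cylinder /= size_mkseq.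
Qed.
End captured_sets.

(** * Leftmost members of Pi^0_1 classes *)

Lemma turing_prefix_num X s :
  fun_turing_le s X -> fun_turing_le (fun n => prefix_num X (s n)) X.
Proof.
move=> cs; rewrite /prefix_num.
apply: (@turing_sum X (fun _ i => X i * 2 ^ i)) => //; turing.
by apply: turing_oracle; turing.
Qed.

Lemma bit_prefix_num X n j : j < n -> bit (prefix_num X n) j = X j.
Proof.
move=> jn; have := modn_bit (prefix_num X n) j.
rewrite (prefix_num_mod _ jn) (prefix_num_mod _ (ltnW jn)) prefix_numS => /addnI.
have : 0 < 2 ^ j by rewrite expn_gt0.
by case: (X j); case: (bit _ _); lia.
Qed.

Section leftmost_path.
Variable G : nat -> bool.

(* An n in G codes ((s, t), w) and forbids the string t of length s as a prefix. *)
Definition avoids (X : nat -> bool) : Prop :=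
  forall n, G n -> prefix_num X (fstn (fstn n)) != sndn (fstn n).

(* By compactness, the string t of length s has no extension avoiding G iff it is
   killed for some L. Working with this finitary notion, monotone in L, makes an
   appeal to compactness unnecessary. *)
Definition killed (L s t : nat) : bool :=
  (s <= L) && all (fun y => (y %% 2 ^ s == t) ==> has (fun n =>
    [&& G n, fstn (fstn n) <= L & y %% 2 ^ fstn (fstn n) == sndn (fstn n)])
    (iota 0 L)) (iota 0 (2 ^ L)).

Lemma killedP L s t : killed L s t <-> s <= L /\
  forall y, y %% 2 ^ s = t -> exists n,
    [/\ n < L, G n, fstn (fstn n) <= L & y %% 2 ^ fstn (fstn n) = sndn (fstn n)].
Proof.
have mod2 y j k : j <= k -> (y %% 2 ^ k) %% 2 ^ j = y %% 2 ^ j.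
  by move=> jk; rewrite modn_dvdm // dvdn_exp2l.
split=> [/andP[sL /allP_iota H]|[sL H]].
  split=> // y yt; have /implyP := H (y %% 2 ^ L) (ltn_pmod y (expn_gt0 2 L)).
  rewrite mod2 // yt eqxx => /(_ isT) /hasP_iota[n nL /and3P[h1 h2 h3]].
  by exists n; split=> //; rewrite mod2 // in h3; exact/eqP.
rewrite /killed sL; apply/allP_iota => y yL; apply/implyP => /eqP /H[n [h1 h2 h3 h4]].
by apply/hasP_iota; exists n => //; rewrite h2 h3 h4 eqxx.
Qed.

Lemma killed_extend L L' s s' t t' : L <= L' -> s <= s' <= L' -> t' %% 2 ^ s = t ->
  killed L s t -> killed L' s' t'.
Proof.
move=> LL' /andP[ss' sL'] tE /killedP[sL H]; apply/killedP; split=> // y yt.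
have [|n [h1 h2 h3 h4]] := H y.
  by rewrite -tE -yt modn_dvdm // dvdn_exp2l.
by exists n; split=> //; exact: leq_trans LL'.
Qed.

Definition dead (s t : nat) : bool := `[< exists L, killed L s t >].

Lemma dead_extend s s' t t' : s <= s' -> t' %% 2 ^ s = t -> dead s t -> dead s' t'.
Proof.
move=> ss' tE /asboolP[L h]; apply/asboolP; exists (maxn L s').
by apply: killed_extend h => //; rewrite ?leq_maxl // ss' leq_maxr.
Qed.

(** The numbers t and t + 2 ^ s code the extensions of the string by 0 and by 1. *)
Lemma dead_split s t : dead s.+1 t -> dead s.+1 (t + 2 ^ s) -> dead s t.
Proof.
move=> /asboolP[L /killedP[sL H]] /asboolP[L' /killedP[sL' H']].
apply/asboolP; exists (maxn L L'); apply/killedP; split.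
  by rewrite leq_max ltnW.
move=> y yt; have := modn_bit y s; rewrite yt; case: (bit y s).
  rewrite mul1n => /H'[n [h1 h2 h3 h4]].
  by exists n; split=> //; rewrite leq_max ?h1 ?h3 orbT.
rewrite addn0 => /H[n [h1 h2 h3 h4]].
by exists n; split=> //; rewrite leq_max ?h1 ?h3.
Qed.

(** Read with length n+1, [prefix_num Z n] is the prefix of length n followed by 0; Z takes the bit
    1 exactly when this string is dead. *)
Lemma leftmost_path_exists : exists Z, forall n, Z n = dead n.+1 (prefix_num Z n).
Proof.
pose p n := iteri n (fun n r => r + dead n.+1 r * 2 ^ n) 0.
exists (fun n => dead n.+1 (p n)) => n; congr dead.
by elim: n => [|n IH]; rewrite ?prefix_numS -?IH // /prefix_num big_ord0.
Qed.

(** The empty string is alive because a prefix of X would refute any bound L killing it. A live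
    string has a live one-bit extension, and Z chooses one. *)
Lemma leftmost_path_alive X Z n : avoids X ->
  (forall n, Z n = dead n.+1 (prefix_num Z n)) -> ~~ dead n (prefix_num Z n).
Proof.
move=> GX ZE; elim: n => [|n IH].
  apply/negP => /asboolP[L /killedP[_ /(_ (prefix_num X L))]].
  rewrite /prefix_num big_ord0 modn1 -/(prefix_num X L) => /(_ erefl)[n [_ Gn nL]].
  by rewrite prefix_num_mod //; apply/eqP/GX.
rewrite prefix_numS ZE; case: (boolP (dead n.+1 (prefix_num Z n))) => h.
  by apply: contra IH; rewrite mul1n; exact: dead_split.
by rewrite addn0.
Qed.

Lemma leftmost_path_avoids X Z : avoids X ->
  (forall n, Z n = dead n.+1 (prefix_num Z n)) -> avoids Z.
Proof.
(* L is large enough for the single code n to kill the prefix of Z of length L. *)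
move=> GX ZE n Gn; apply/negP => /eqP e; pose L := maxn n.+1 (fstn (fstn n)).
have /negP := leftmost_path_alive L GX ZE; apply; apply/asboolP; exists L.
apply/killedP; split=> // y yL; exists n; rewrite leq_maxl leq_maxr; split=> //.
by rewrite -e -(@prefix_num_mod Z L) ?leq_maxr // -yL modn_dvdm // dvdn_exp2l // leq_maxr.
Qed.

(* With x = (s, t), the string t of length s is lexicographically at most the
   leftmost path, as every 1 in it branches off from a dead 0. *)
Definition left_cut (x : nat) : bool :=
  `[< forall i, i < fstn x -> bit (sndn x) i -> dead i.+1 (sndn x %% 2 ^ i) >].

(** Only the first disagreement with Z matters: if the string has 0 there and Z has 1, that 0 is
    dead, and so is every later extension of it. *)
Lemma left_cutE Z x : (forall n, Z n = dead n.+1 (prefix_num Z n)) ->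
  left_cut x = all (fun i => all (fun j => bit (sndn x) j == Z j) (iota 0 i) ==>
    (bit (sndn x) i ==> Z i)) (iota 0 (fstn x)).
Proof.
move=> ZE; rewrite /left_cut; move: (fstn x) (sndn x) => s t.
have agree i : (forall j, j < i -> bit t j = Z j) -> t %% 2 ^ i = prefix_num Z i.
  move=> H; rewrite -prefix_num_bit; apply: eq_bigr => j _; by rewrite H.
apply/asboolP/allP_iota => H i si.
  apply/implyP => /allP_iota tZ; apply/implyP => ti.
  have ag : forall j, j < i -> bit t j = Z j by move=> j /tZ/eqP.
  by rewrite ZE -(agree _ ag); exact: H.
move=> ti; have [/allP_iota tZ|] := boolP (all (fun j => bit t j == Z j) (iota 0 i)).
  have ag : forall j, j < i -> bit t j = Z j by move=> j /tZ/eqP.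
  rewrite (agree _ ag) -ZE; have := H i si.
  by move=> /implyP/(_ (introT (allP_iota _ _) tZ))/implyP/(_ ti).
rewrite -has_predC => /hasP_iota dif.
have ex : exists j, (j < i) && (bit t j != Z j).
  by case: dif => j ji h; exists j; rewrite ji.
case: (ex_minnP ex) => j /andP[ji tj] jmin.
have tZ k : k < j -> bit t k = Z k.
  move=> kj; apply/eqP/negPn/negP => h.
  by have := jmin k; rewrite h (ltn_trans kj ji) => /(_ isT); rewrite leqNgt kj.
have := H j (ltn_trans ji si).
have -> : all (fun k => bit t k == Z k) (iota 0 j) by apply/allP_iota => k /tZ ->.
move=> /= tjZ; have [tj0 Zj] : bit t j = false /\ Z j.
  by move: tj tjZ; case: (bit t j); case: (Z j).
rewrite ZE -(agree _ tZ) in Zj; apply: dead_extend Zj; first by rewrite ltnS ltnW.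
by rewrite [_ %% 2 ^ i %% _]modn_dvdm ?dvdn_exp2l // modn_bit tj0 addn0.
Qed.

(** Since [killed] is monotone in L, one L serves all the finitely many positions; this gives a
    single existential over a decidable condition. *)
Lemma left_cut_ce : left_cut = (fun x => `[< exists L,
  all (fun i => bit (sndn x) i ==> killed L i.+1 (sndn x %% 2 ^ i)) (iota 0 (fstn x)) >])
  :> (nat -> bool).
Proof.
apply/funext => x; rewrite /left_cut; move: (fstn x) (sndn x) => s t.
apply/asboolP/asboolP => [H|[L /allP_iota H] i si ti]; last first.
  by apply/asboolP; exists L; have := H i si; rewrite ti.
elim: s H => [|s IH] H; first by exists 0.
have [|L /allP_iota HL] := IH; first by move=> i si; apply: H; exact: ltnW.
have [L' HL'] : exists L', bit t s ==> killed L' s.+1 (t %% 2 ^ s).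
  by case: (boolP (bit t s)) => [/(H s (leqnn _))/asboolP|]; [|exists 0].
exists (maxn L L'); apply/allP_iota => i si; apply/implyP => ti.
have mono M : M <= maxn L L' -> killed M i.+1 (t %% 2 ^ i) ->
    killed (maxn L L') i.+1 (t %% 2 ^ i).
  move=> ML h; apply: (killed_extend ML _ _ h); last first.
    by rewrite modn_small // (leq_trans (ltn_pmod _ _)) ?expn_gt0 ?leq_exp2l.
  by rewrite leqnn (leq_trans _ ML) //; case/killedP: h.
move: si; rewrite ltnS leq_eqVlt => /orP[/eqP si|si].
  by apply: (mono L'); rewrite ?leq_maxr //; move: HL'; rewrite -si ti.
by apply: (mono L); rewrite ?leq_maxl //; have := HL i si; rewrite ti.
Qed.

Lemma turing_leftmost_left_cut Z : (forall n, Z n = dead n.+1 (prefix_num Z n)) ->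
  turing_equiv left_cut Z.
Proof.
move=> ZE; split.
  apply: (@turing_ext Z (fun x => nat_of_bool (all (fun i =>
    all (fun j => bit (sndn x) j == Z j) (iota 0 i) ==>
    (bit (sndn x) i ==> Z i)) (iota 0 (fstn x))))).
    by move=> x; rewrite -left_cutE.
  by turing; apply: turing_oracle; turing.
(* The prefix of Z of length n followed by 1 is in the left cut exactly when Z n is 1, so the cut
   computes Z bit by bit. *)
have stepE n : Z n = left_cut (pairn n.+1 (prefix_num Z n + 2 ^ n)).
  rewrite (left_cutE _ ZE) fstn_pair sndn_pair; apply/idP/allP_iota => [Zn i|H].
    rewrite ltnS leq_eqVlt => /orP[/eqP ->|ni].
      by rewrite Zn !implybT.
    rewrite bit_add_expn ?prefix_num_lt // bit_prefix_num // (ltn_eqF ni) orbF.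
    by rewrite implybb implybT.
  have := H n (leqnn _); rewrite bit_add_expn ?prefix_num_lt // eqxx orbT /=.
  have -> // : all (fun j => bit (prefix_num Z n + 2 ^ n) j == Z j) (iota 0 n).
  apply/allP_iota => j jn; rewrite bit_add_expn ?prefix_num_lt // bit_prefix_num //.
  by rewrite (ltn_eqF jn) orbF.
pose N := left_cut.
have cp : fun_turing_le (prefix_num Z) N.
  apply: (@turing_ext N (fun n =>
      iteri n (fun i r => r + N (pairn i.+1 (r + 2 ^ i)) * 2 ^ i) 0)).
    elim=> [|n IH]; first by rewrite /prefix_num big_ord0.
    by rewrite prefix_numS stepE -IH.
  apply: (@turing_iteri_closed N (fun=> 0) (fun n => n)
    (fun i r => r + N (pairn i.+1 (r + 2 ^ i)) * 2 ^ i)); turing.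
  by apply: turing_oracle; turing.
apply: (@turing_ext N (fun n => nat_of_bool (N (pairn n.+1 (prefix_num Z n + 2 ^ n))))).
  by move=> n; rewrite /N -stepE.
by apply: turing_oracle; turing.
Qed.

Lemma turing_killed A (L s t : nat -> nat) :
  fun_turing_le (fun n => nat_of_bool (G n)) A ->
  fun_turing_le L A -> fun_turing_le s A -> fun_turing_le t A ->
  fun_turing_le (fun p => nat_of_bool (killed (L p) (s p) (t p))) A.
Proof.
move=> cG cL cs ct.
suff H : fun_turing_le (fun q => nat_of_bool (killed (fstn q) (fstn (sndn q))
    (sndn (sndn q)))) A.
  have := turing_comp H (turing_pair cL (turing_pair cs ct)).
  by apply: turing_ext => n; rewrite !(fstn_pair, sndn_pair).
rewrite /killed; turing.
exact: turing_comp cG (turing_snd A).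
Qed.

Lemma Pi1_basis_ce A X : fun_turing_le (fun n => nat_of_bool (G n)) A -> avoids X ->
  exists Z, avoids Z /\ degree_ce_in Z A.
Proof.
move=> cG GX; have [Z ZE] := leftmost_path_exists.
exists Z; split; first exact: leftmost_path_avoids GX ZE.
exists left_cut; split; first exact: turing_leftmost_left_cut.
rewrite left_cut_ce.
rewrite (_ : mkset _ = [set x | exists L, all (fun i => bit (sndn x) i ==>
    killed L i.+1 (sndn x %% 2 ^ i)) (iota 0 (fstn x))]); last first.
  by apply/seteqP; split=> x /= => [/asboolP|?] //; apply/asboolP.
apply: (@ce_in_exists A (fun x L => all (fun i => bit (sndn x) i ==>
    killed L i.+1 (sndn x %% 2 ^ i)) (iota 0 (fstn x)))).
by turing; apply: turing_killed; turing.
Qed.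
End leftmost_path.

(** * Domination *)

Lemma captured_limit e s t : exists u, forall v, u <= v ->
  captured (zero_jump_stage v) e s t = captured zero_jump e s t.
Proof.
have [u hu] := zero_jump_stage_limit s; exists u => v uv.
by apply: captured_local => i; exact: hu.
Qed.

(* With n = ((s, t), (e, u)), stage v >= u is a witness against the claim that the
   string t of length s is captured at all stages from u on. *)
Definition refuted (n v : nat) : bool := (sndn (sndn n) <= v) &&
  ~~ captured (zero_jump_stage v) (fstn (sndn n)) (fstn (fstn n)) (sndn (fstn n)).

Lemma turing_refuted X : fun_turing_le (fun q => nat_of_bool (refuted (fstn q) (sndn q))) X.
Proof. by rewrite /refuted; turing; apply: turing_captured; turing. Qed.

Lemma refuted_exists X n : (forall e s, ~ captured_set e s X) ->
  prefix_num X (fstn (fstn n)) = sndn (fstn n) -> exists v, refuted n v.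
Proof.
move=> XQ Xn.
have [u hu] := captured_limit (fstn (sndn n)) (fstn (fstn n)) (sndn (fstn n)).
exists (maxn u (sndn (sndn n))); rewrite /refuted leq_maxr hu ?leq_maxl // -Xn.
exact/negP/XQ.
Qed.

(** A null set and a set of measure at most 1/2 cannot cover the space. *)
Lemma ae_uncaptured (R : realType) (P : cantor_set -> Prop) :
  {ae fair_coin R, forall X, P X} ->
  exists X, P X /\ forall e s, ~ captured_set e s X.
Proof.
move=> [N [mN N0 PN]]; apply: contrapT => noX.
set B := \bigcup_e \bigcup_s captured_set e s.
have mB : measurable (B : set cantor_set).
  apply: bigcupT_measurable => e; apply: bigcupT_measurable => s.
  exact: measurable_captured_set.
have NB : setT `<=` N `|` B.
  move=> X _; have [XB|XB] := pselect (B X); [by right|left; apply: PN => /= PX].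
  by apply: noX; exists X; split=> // e s h; apply: XB; exists e => //; exists s.
have : (fair_coin R setT <= fair_coin R (N `|` B))%E.
  by apply: le_measure; rewrite ?inE //; exact: measurableU.
rewrite probability_setT leNgt => /negP; apply.
apply: (le_lt_trans (@measureU2 _ _ _ (fair_coin R) _ _ mN mB)).
apply: (le_lt_trans (leeD (lexx _) (measure_captured R))).
rewrite [X in (X + _)%E]N0 add0e lte_fin; lra.
Qed.

Theorem theorem4p7 (R : realType) (A : nat -> bool) :
  ae_dominating R A -> exists Z : nat -> bool, two_random R Z /\ degree_ce_in Z A.
Proof.
move=> /ae_uncaptured[X [Xdom XQ]].
(* The first disjunct stops the search at 0 when the string is not a prefix of X, which makes g
   total. *)
pose P n v := (prefix_num X (fstn (fstn n)) != sndn (fstn n)) || refuted n v.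
have exP n : exists v, P n v.
  rewrite /P; case: eqP => [Xn|_]; last by exists 0.
  exact: refuted_exists XQ Xn.
pose g n := ex_minn (exP n).
have gP n : P n (g n) by rewrite /g; case: ex_minnP.
have [|f [c fA] [m fg]] := Xdom g.
  apply: (@turing_min X P).
  - rewrite /P; turing; first by apply: turing_prefix_num; turing.
    by apply: (turing_bool2 (turing_refuted X)); turing.
  - exact: gP.
  - move=> n i; rewrite /g; case: ex_minnP => v _ vmin iv.
    by apply/negP => /vmin; rewrite leqNgt iv.
(* Adding this constant extends the domination to the arguments up to m and keeps the bound
   computable in A. *)
pose K := \sum_(i < m.+1) g i.
have gfK n : g n <= f n + K.
  have [nm|/fg/ltnW mn] := leqP n m; last exact: leq_trans (leq_addr _ _).
  apply: leq_trans (leq_addl _ _); rewrite /K.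
  by rewrite (bigD1 (Ordinal (nm : n < m.+1))) //= leq_addr.
pose G n := all (fun v => ~~ refuted n v) (iota 0 (f n + K).+1).
have cG : fun_turing_le (fun n => nat_of_bool (G n)) A.
  rewrite /G; turing; last by exists c.
  by apply: (turing_bool2 (turing_refuted A)); turing.
have GX : avoids G X.
  move=> n /allP_iota Gn; apply/negP => Xn.
  by have := gP n; rewrite /P Xn /= => h; have := Gn (g n); rewrite h ltnS gfK => /(_ isT).
have [Z [GZ Zce]] := Pi1_basis_ce cG GX.
exists Z; split=> // U UML ZU; have [e [s Zs]] := captured_test UML ZU.
have [u hu] := captured_limit e s (prefix_num Z s).
(* If Z is captured, the approximations agree from u on, so this n is never refuted; G then forbids
   a prefix of Z. *)
pose n := pairn (pairn s (prefix_num Z s)) (pairn e u).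
have /GZ : G n.
  apply/allP_iota => v _; rewrite /refuted /n !(fstn_pair, sndn_pair).
  by apply/negP => /andP[/hu -> /negP]; apply.
by rewrite /n !(fstn_pair, sndn_pair) eqxx.
Qed.
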